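(* Let $N\ge 3$, let $\mathbf d\in\mathbb R^N$, and let $\lambda\in\mathbb R$ be such that $\mathbf Q_\lambda=\mathbf I_N+\lambda\mathbf D^\top\mathbf D$ is positive definite. Let $\boldsymbol\xi\in\mathbb R^N$ be any fixed vector and set $\mathbf x_1=\mathbf A\boldsymbol\xi$, $\mathbf x_2=\mathbf B\boldsymbol\xi$. Then $$D_\lambda(\mathbf x_1\|\mathbf x_2)=\big\|(\mathbf A-\mathbf B)\boldsymbol\xi\big\|_{\mathbf Q_\lambda}^2=\big[(\mathbf A-\mathbf B)\boldsymbol\xi\big]^\top(\mathbf I_N+\lambda\mathbf D^\top\mathbf D)\big[(\mathbf A-\mathbf B)\boldsymbol\xi\big].$$ In particular, $D_\lambda(\mathbf x_1\|\mathbf x_2)=0$ if and only if $(\mathbf A-\mathbf B)\boldsymbol\xi\in\ker(\mathbf Q_\lambda)=\{\mathbf 0\}$, i.e. if and only if $\mathbf A\boldsymbol\xi=\mathbf B\boldsymbol\xi$.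
   Context: $\mathbf D\in\mathbb R^{(N-2)\times N}$ is the second-difference matrix, $(\mathbf D\mathbf x)_i=x_i-2x_{i+1}+x_{i+2}$ for $i=1,\dots,N-2$. $\mathbf\Pi=\big(\mathbf 1_N\mid(1,2,\dots,N)^\top\big)\in\mathbb R^{N\times 2}$, whose columns span $\ker\mathbf D$. $\mathbf F=\mathbf D^\top(\mathbf D\mathbf D^\top)^{-1}$ is the Moore--Penrose pseudoinverse of $\mathbf D$, and $\mathbf S=\mathbf F+\mathbf\Pi\mathbf M$ with $\mathbf M\in\mathbb R^{2\times(N-2)}$ arbitrary. The A-representation is $\mathbf A=(\mathbf\Pi\mid\mathbf S)\in\mathbb R^{N\times N}$ and the B-representation is $\mathbf B=(\mathbf\Pi\mid\mathbf F)\in\mathbb R^{N\times N}$. $f_\lambda(\mathbf x)=\|\mathbf d-\mathbf x\|_2^2+\lambda\|\mathbf D\mathbf x\|_2^2$ for $\mathbf x\in\mathbb R^N$, and its Bregman divergence is $D_\lambda(\mathbf x_1\|\mathbf x_2):=f_\lambda(\mathbf x_1)-f_\lambda(\mathbf x_2)-\nabla f_\lambda(\mathbf x_2)^\top(\mathbf x_1-\mathbf x_2)$. For a symmetric positive definite matrix $\mathbf Q$, $\|\mathbf v\|_{\mathbf Q}^2:=\mathbf v^\top\mathbf Q\mathbf v$. *)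

(* Defs.v *)
From mathcomp Require Export all_boot all_order all_algebra.
From mathcomp Require Export all_classical all_reals all_analysis.
Export Order.TTheory GRing.Theory Num.Theory.
Export numFieldNormedType.Exports.
Set Implicit Arguments.
Unset Strict Implicit.
Unset Printing Implicit Defensive.
Local Open Scope classical_set_scope.
Local Open Scope ring_scope.

(* The rows are indexed from 0, so row i of D x is x_i - 2 x_(i+1) + x_(i+2)
   in the 0-based coordinates of x (see diff2_mulE). *)
Definition diff2 (R : realType) (N : nat) : 'M[R]_(N - 2, N) :=
  \matrix_(i, j) ((j == i :> nat)%:R - 2 * (j == i.+1 :> nat)%:R
                  + (j == i.+2 :> nat)%:R).

Lemma diff2_mulE (R : realType) (N : nat) (x : 'cV[R]_N) (i : 'I_(N - 2))
    (j0 j1 j2 : 'I_N) :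
  j0 = i :> nat -> j1 = i.+1 :> nat -> j2 = i.+2 :> nat ->
  (diff2 R N *m x) i 0 = x j0 0 - 2 * x j1 0 + x j2 0.
Proof.
move=> e0 e1 e2.
have pick (j' : 'I_N) (k : nat) : j' = k :> nat ->
    \sum_(j < N) (j == k :> nat)%:R * x j 0 = x j' 0.
  move=> ejk; rewrite (bigD1 j')//= ejk eqxx mul1r big1 ?addr0// => j.
  by rewrite -val_eqE /= ejk => /negPf->; rewrite mul0r.
rewrite !mxE -(pick _ _ e0) -(pick _ _ e1) -(pick _ _ e2).
rewrite mulr_sumr -sumrN -!big_split/=; apply: eq_bigr => j _.
by rewrite !mxE mulrDl mulrDl mulNr mulrA.
Qed.

Definition trend_mx (R : realType) (N : nat) : 'M[R]_(N, 2) :=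
  row_mx (const_mx 1 : 'cV[R]_N) (\col_(i < N) i.+1%:R).

(* D has full row rank, so invmx is a genuine inverse here and this is the
   Moore-Penrose pseudoinverse of D. *)
Definition pinv_diff2 (R : realType) (N : nat) : 'M[R]_(N, N - 2) :=
  (diff2 R N)^T *m invmx (diff2 R N *m (diff2 R N)^T).

Definition synth_mx (R : realType) (N : nat) (M : 'M[R]_(2, N - 2)) :
    'M[R]_(N, N - 2) :=
  pinv_diff2 R N + trend_mx R N *m M.

(* The castmx only identifies the widths 2 + (N - 2) and N. *)
Definition A_rep (R : realType) (N : nat) (hN : (3 <= N)%N)
    (M : 'M[R]_(2, N - 2)) : 'M[R]_N :=
  castmx (erefl N, subnKC (ltnW hN)) (row_mx (trend_mx R N) (synth_mx M)).

Definition B_rep (R : realType) (N : nat) (hN : (3 <= N)%N) : 'M[R]_N :=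
  castmx (erefl N, subnKC (ltnW hN))
    (row_mx (trend_mx R N) (pinv_diff2 R N)).

(* The Euclidean norm; the library norm `|v| on matrices is the sup norm. *)
Definition norm2 (R : realType) (n : nat) (v : 'cV[R]_n) : R :=
  Num.sqrt (\sum_(i < n) v i 0 ^+ 2).

(* The vector of partial derivatives; the choice of norm on 'cV[R]_n does not
   affect them. *)
Definition gradient (R : realType) (n : nat) (f : 'cV[R]_n -> R)
    (x : 'cV[R]_n) : 'cV[R]_n :=
  \col_(i < n) 'D_(delta_mx i 0) (f : 'cV[R]_n -> R^o) x.

Definition bregman (R : realType) (n : nat) (f : 'cV[R]_n -> R)
    (x1 x2 : 'cV[R]_n) : R :=
  f x1 - f x2 - ((gradient f x2)^T *m (x1 - x2)) 0 0.

Definition objective (R : realType) (N : nat) (d : 'cV[R]_N) (lambda : R)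
    (x : 'cV[R]_N) : R :=
  norm2 (d - x) ^+ 2 + lambda * norm2 (diff2 R N *m x) ^+ 2.

Definition Qmx (R : realType) (N : nat) (lambda : R) : 'M[R]_N :=
  1%:M + lambda *: ((diff2 R N)^T *m diff2 R N).

Definition sqnormQ (R : realType) (n : nat) (Q : 'M[R]_n) (v : 'cV[R]_n) : R :=
  (v^T *m Q *m v) 0 0.

Definition posdefmx (R : realType) (n : nat) (Q : 'M[R]_n) : Prop :=
  Q^T = Q /\ forall v : 'cV[R]_n, v != 0 -> 0 < sqnormQ Q v.

(* Kernel of v |-> Q v on column vectors; kermx is the left (row) kernel. *)
Definition colker (R : realType) (m n : nat) (Q : 'M[R]_(m, n)) :
    set 'cV[R]_n :=
  [set v | Q *m v = 0].

(* Main.v *)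
(* The objective is a quadratic polynomial with quadratic part
   h |-> h^T Q_lambda h, so subtracting its first-order expansion at x leaves
   exactly the Q_lambda-norm of the increment, for arbitrary x1 and x2. *)
Require Import Defs.
From mathcomp Require Import ring.

Local Open Scope classical_set_scope.
Local Open Scope ring_scope.

Lemma sqr_norm2E (R : realType) (n : nat) (v : 'cV[R]_n) :
  norm2 v ^+ 2 = (v^T *m v) 0 0.
Proof.
rewrite sqr_sqrtr ?sumr_ge0// => [|i _]; last exact: sqr_ge0.
by rewrite mxE; apply: eq_bigr => i _; rewrite mxE expr2.
Qed.

Lemma sqr_norm2D (R : realType) (n : nat) (u v : 'cV[R]_n) :
  norm2 (u + v) ^+ 2 = norm2 u ^+ 2 + 2 * (u^T *m v) 0 0 + norm2 v ^+ 2.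
Proof.
rewrite !sqr_norm2E !mxE mulr_sumr -!big_split/=.
by apply: eq_bigr => i _; rewrite !mxE; ring.
Qed.

(** The form [h^T Q h] splits along the two summands of [Qmx], since [h^T D^T D h] is the squared
    norm of [D h]. This is [objective] at [d = 0], hence its purely quadratic part. *)
Lemma sqnormQ_Qmx (R : realType) (N : nat) (lambda : R) (h : 'cV[R]_N) :
  sqnormQ (Qmx N lambda) h =
  norm2 h ^+ 2 + lambda * norm2 (diff2 R N *m h) ^+ 2.
Proof.
rewrite /sqnormQ /Qmx mulmxDr mulmxDl mulmx1 -scalemxAr -scalemxAl.
by rewrite !sqr_norm2E mxE [X in _ + X]mxE trmx_mul !mulmxA.
Qed.

Lemma sqnormQZ (R : realType) (n : nat) (Q : 'M[R]_n) (t : R) (v : 'cV[R]_n) :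
  sqnormQ Q (t *: v) = t ^+ 2 * sqnormQ Q v.
Proof.
rewrite /sqnormQ -scalemxAr linearZ/= -!scalemxAl scalerA -expr2.
by rewrite mxE.
Qed.

(** Both squared norms are expanded around [x]: their cross terms form the linear part, their
    squares in [h] the quadratic part. The expansion is exact, and the vector paired with [h] turns
    out to be the gradient at [x]. *)
Lemma objectiveD (R : realType) (N : nat) (d : 'cV[R]_N) (lambda : R)
    (x h : 'cV[R]_N) :
  objective d lambda (x + h) = objective d lambda x
    + ((2 *: (x - d + lambda *: ((diff2 R N)^T *m (diff2 R N *m x))))^T *m h) 0 0
    + sqnormQ (Qmx N lambda) h.
Proof.
(* The residual [d - (x + h)] is read as [(d - x) + (- h)]; the signs in its square and cross term
   are cleared below. *)
rewrite sqnormQ_Qmx /objective mulmxDr opprD addrA !sqr_norm2D.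
have -> : norm2 (- h) ^+ 2 = norm2 h ^+ 2.
  by rewrite !sqr_norm2E mulmxN [(- h)^T]linearN/= mulNmx opprK.
set D := diff2 R N.
have -> : ((2 *: (x - d + lambda *: (D^T *m (D *m x))))^T *m h) 0 0 =
    2 * (((x - d)^T *m h) 0 0 + lambda * ((D *m x)^T *m (D *m h)) 0 0).
  rewrite linearZ/= -scalemxAl mxE linearD/= mulmxDl mxE linearZ/= -scalemxAl.
  by rewrite [X in _ + X]mxE trmx_mul trmxK !mulmxA.
have -> : ((d - x)^T *m - h) 0 0 = ((x - d)^T *m h) 0 0.
  by rewrite -opprB mulmxN [(- (x - d))^T]linearN/= mulNmx opprK.
ring.
Qed.

(** Along the line through [x] in direction [v], the difference quotient is [l + t * q], which tends
    to [l] as [t] tends to 0. *)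
Lemma derive_quadratic (R : realType) (V : normedModType R) (f : V -> R^o)
    (x v : V) (l q : R) :
  (forall t : R, f (x + t *: v) = f x + t * l + t ^+ 2 * q) -> 'D_v f x = l.
Proof.
move=> fE; apply: cvg_lim; first exact: norm_hausdorff.
have cvgl : (l + t * q) @[t --> 0^'] --> (l : R^o).
  rewrite -[X in _ --> X]addr0 -[X in _ --> _ + X](mul0r q).
  apply: cvgD; first exact: cvg_cst.
  by apply: cvgM; [exact: nbhs_dnbhs|exact: cvg_cst].
(* The quotient equals [l + t * q] only for [t != 0], which suffices on punctured neighbourhoods. *)
apply: cvg_trans cvgl; apply: near_eq_cvg; near=> t.
have t0 : t != 0 by near: t; exact: nbhs_dnbhs_neq.
by rewrite /= [_ + x]addrC fE /GRing.scale/=; field.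
Unshelve. all: by end_near. Qed.

Lemma gradient_objective (R : realType) (N : nat) (d : 'cV[R]_N) (lambda : R)
    (x : 'cV[R]_N) :
  gradient (objective d lambda) x =
  2 *: (x - d + lambda *: ((diff2 R N)^T *m (diff2 R N *m x))).
Proof.
apply/colP => i; rewrite mxE; set g := _ *: _.
(* Along the [i]-th basis vector, the linear coefficient is the [i]-th entry of [g]. *)
apply: (@derive_quadratic _ _ _ _ _ _
  (sqnormQ (Qmx N lambda) (delta_mx i 0))) => t.
rewrite objectiveD sqnormQZ -scalemxAr mxE -/g; congr (_ + t * _ + _).
by rewrite -colE !mxE.
Qed.

Lemma bregman_objective (R : realType) (N : nat) (d : 'cV[R]_N) (lambda : R)
    (x1 x2 : 'cV[R]_N) :
  bregman (objective d lambda) x1 x2 = sqnormQ (Qmx N lambda) (x1 - x2).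
Proof.
(* Only the first [x1] becomes [x2 + (x1 - x2)]; after expansion the linear term cancels the
   gradient term. *)
rewrite /bregman gradient_objective -{1}(subrKC x2 x1).
by rewrite objectiveD; ring.
Qed.

Lemma posdefmx_sqnormQ_eq0 (R : realType) (n : nat) (Q : 'M[R]_n)
    (v : 'cV[R]_n) : posdefmx Q -> sqnormQ Q v = 0 <-> v = 0.
Proof.
move=> [_ Qpos]; split=> [Qv0|->]; last by rewrite /sqnormQ mulmx0 mxE.
by apply/eqP; apply: contraTT isT => /Qpos; rewrite Qv0 ltxx.
Qed.

Lemma posdefmx_colker (R : realType) (n : nat) (Q : 'M[R]_n) :
  posdefmx Q -> colker Q = [set 0].
Proof.
move=> Qpos; apply/seteqP; split=> v /= => [Qv0|->].
  apply/(posdefmx_sqnormQ_eq0 _ _ _ _ Qpos).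
  (* Reassociating as [v^T (Q v)] shows that a kernel vector annihilates the form. *)
  by rewrite /sqnormQ -mulmxA Qv0 mulmx0 mxE.
by rewrite /colker /= mulmx0.
Qed.

Theorem proposition2 (R : realType) (N : nat) (hN : (3 <= N)%N)
    (d : 'cV[R]_N) (lambda : R) (hQ : posdefmx (Qmx N lambda))
    (M : 'M[R]_(2, N - 2)) (xi : 'cV[R]_N) :
  let A := A_rep hN M in
  let B := B_rep R hN in
  let x1 := A *m xi in
  let x2 := B *m xi in
  let D := diff2 R N in
  let v := (A - B) *m xi in
  let Div := bregman (objective d lambda) x1 x2 in
  [/\ Div = sqnormQ (Qmx N lambda) v,
      sqnormQ (Qmx N lambda) v =
        (v^T *m (1%:M + lambda *: (D^T *m D)) *m v) 0 0,
      Div = 0 <-> v \in colker (Qmx N lambda),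
      colker (Qmx N lambda) = [set 0] &
      Div = 0 <-> A *m xi = B *m xi].
Proof.
move=> A B x1 x2 D v Div.
have DivE : Div = sqnormQ (Qmx N lambda) v.
  by rewrite /Div bregman_objective /v mulmxBl.
have Div0 : Div = 0 <-> v = 0 by rewrite DivE; exact: posdefmx_sqnormQ_eq0.
(* The explicit matrix formula holds by unfolding [sqnormQ] and [Qmx]. *)
split=> //.
- by rewrite posdefmx_colker// in_setE.
- exact: posdefmx_colker.
- rewrite Div0 /v mulmxBl; split=> [/eqP|->]; last by rewrite subrr.
  by rewrite subr_eq0 => /eqP.
Qed.
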